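(* Let $r$ and $k$ be fixed nonnegative integers. Then, as $n\to\infty$, the number of $123$-avoiding permutations of $\{1,2,\dots,n\}$ with exactly $r$ occurrences of the pattern $(k-1)(k-2)\dots1k$ equals $$\left(\frac{4\sin^2\frac{\pi}{k+1}}{k+1}\right)^{r+1}\frac{n^r}{r!}\left(4\cos^2\frac{\pi}{k+1}\right)^{n-r}\left(1+O\left(\frac1n\right)\right).$$
   Context: For a permutation $\pi=\pi_1\cdots\pi_n$ of $\{1,\dots,n\}$ and a permutation $\sigma=\sigma_1\cdots\sigma_m$ of $\{1,\dots,m\}$, an occurrence of the pattern $\sigma$ in $\pi$ is a choice of indices $i_1<\dots<i_m$ such that $\pi_{i_1}\cdots\pi_{i_m}$ is in the same relative order as $\sigma$; $\pi$ is $\sigma$-avoiding if there is no occurrence. The pattern $(k-1)(k-2)\dots1k$ is the permutation of $\{1,\dots,k\}$ whose first $k-1$ entries are $k-1,\dots,1$ and whose last entry is $k$. Here $\pi$ in $\sin,\cos$ denotes the number $3.14159\ldots$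
   Formalization: The case k = 0 is excluded (k ≥ 1 is assumed): the pattern (k-1)(k-2)…1k does not exist for k = 0, and if it is read as the empty pattern the formula fails for r = 1. *)

(* Defs.v *)
From HB Require Import structures.
From mathcomp Require Import all_boot all_order all_algebra all_fingroup.
From mathcomp Require Import zify.

Set Implicit Arguments.
Unset Strict Implicit.
Unset Printing Implicit Defensive.

(* Permutations of {1, ..., n} are elements of 'S_n, with positions and values
   both shifted down by one. *)

Definition is_occurrence (m n : nat) (s : 'S_m) (p : 'S_n)
    (i : {ffun 'I_m -> 'I_n}) : bool :=
  [forall a : 'I_m, forall b : 'I_m, (a < b) ==> (i a < i b)] &&
  [forall a : 'I_m, forall b : 'I_m, (p (i a) < p (i b)) == (s a < s b)].

Definition occurrences (m n : nat) (s : 'S_m) (p : 'S_n) : nat :=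
  #|[set i : {ffun 'I_m -> 'I_n} | is_occurrence s p i]|.

Definition avoids (m n : nat) (s : 'S_m) (p : 'S_n) : bool :=
  occurrences s p == 0.

Definition pattern123 : 'S_3 := 1%g.

Lemma decr_then_max_subproof (k : nat) (i : 'I_k) :
  (if i.+1 == k then i : nat else k - i.+2) < k.
Proof. by case: i => i /= Hi; case: ifP; lia. Qed.

Definition decr_then_max_fun (k : nat) (i : 'I_k) : 'I_k :=
  Ordinal (decr_then_max_subproof i).

Lemma decr_then_max_inj (k : nat) : injective (@decr_then_max_fun k).
Proof.
move=> [i Hi] [j Hj] /(congr1 val) /= H; apply: val_inj => /=.
by move: H; do 2 case: ifP; lia.
Qed.

(* The pattern (k-1)(k-2)...1k: after the shift, position i < k-1 carries the
   value k-2-i, and the last position carries the value k-1.  It is meaningful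
   only for k > 0. *)
Definition decr_then_max (k : nat) : 'S_k := perm (@decr_then_max_inj k).

Definition count_av123 (k r n : nat) : nat :=
  #|[set p : 'S_n | avoids pattern123 p &&
                    (occurrences (decr_then_max k) p == r)]|.

(* Main.v *)
(** In a 123-avoiding permutation the entries that precede and are smaller than
    a given entry [p j] are decreasing, so the occurrences of (k-1)...1k whose
    last letter is [p j] are counted by a binomial coefficient 'C(a_j, k-1).
    Building the permutation from left to right therefore gives a walk on the
    natural numbers, in which a step either climbs by one or lands at some
    height a and then creates 'C(a, k-1) occurrences.  Differences of the walk
    counts in the starting height satisfy the recurrence of paths on the path
    graph with k vertices, whose spectrum is 2 cos (j pi / (k+1)).  A landing at
    height k-1 creates one occurrence and costs one more convolution with a
    sequence of growth (4 cos^2 (pi / (k+1)))^n, hence the factor n^r / r!;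
    higher landings create at least two occurrences and are of lower order. *)
Require Import Defs.
From HB Require Import structures.
From mathcomp Require Import all_boot all_order all_algebra all_fingroup.
From mathcomp Require Import all_classical all_reals all_analysis.
From mathcomp Require Import zify ring lra.

Set Implicit Arguments.
Unset Strict Implicit.
Unset Printing Implicit Defensive.
Import Order.TTheory GRing.Theory Num.Theory.
Import numFieldNormedType.Exports.

(** * Occurrences in 123-avoiding permutations *)

Definition below n (p : 'S_n) (j : 'I_n) : {set 'I_n} :=
  [set i : 'I_n | (i < j) && (p i < p j)].

Lemma avoids123P n (p : 'S_n) :
  reflect (forall i j l : 'I_n, i < j -> j < l -> p i < p j -> p j < p l -> False)
          (avoids pattern123 p).
Proof.
rewrite /avoids /occurrences cards_eq0; apply: (iffP eqP) => [p0 i j l ij jl pij pjl|H].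
  pose f := [ffun a : 'I_3 => nth i [:: i; j; l] a].
  suff : f \in finset.set0 by rewrite inE.
  rewrite -p0 inE; apply/andP; split; apply/forallP => a; apply/forallP => b;
    rewrite !ffunE ?perm1; move: a b => [[|[|[|//]]] ?] [[|[|[|//]]] ?] //=; lia.
apply/setP => f; rewrite !inE; apply/negbTE/negP => /andP[/forallP inc /forallP ord].
have inc' (a b : 'I_3) : a < b -> f a < f b by move/forallP: (inc a) => /(_ b) /implyP.
have ord' (a b : 'I_3) : a < b -> p (f a) < p (f b).
  by move=> ab; move/forallP: (ord a) => /(_ b) /eqP ->; rewrite !perm1.
by apply: (H (f (inord 0)) (f (inord 1)) (f (inord 2)));
  [apply: inc'|apply: inc'|apply: ord'|apply: ord']; rewrite !inordK.
Qed.

(** * Increasing maps and subsets *)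

Section IncreasingMaps.

Variables h n : nat.

Definition increasing (f : {ffun 'I_h -> 'I_n}) : bool :=
  [forall a : 'I_h, forall b : 'I_h, (a < b) ==> (f a < f b)].

Lemma increasingP (f : {ffun 'I_h -> 'I_n}) :
  reflect (forall a b : 'I_h, a < b -> f a < f b) (increasing f).
Proof.
apply: (iffP forallP) => [H a b|H a]; first by move/forallP: (H a) => /(_ b) /implyP.
by apply/forallP => b; apply/implyP; exact: H.
Qed.

Lemma sorted_enum_ord m (A : {pred 'I_m}) :
  sorted (fun x y : 'I_m => x < y) (enum A).
Proof.
rewrite {1}/enum_mem; apply: sorted_filter; first by move=> x y z; exact: ltn_trans.
by rewrite -enumT -(sorted_map (f := val) (e' := ltn)) val_enum_ord iota_ltn_sorted.
Qed.

Lemma increasing_inj (f g : {ffun 'I_h -> 'I_n}) :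
  increasing f -> increasing g -> f @: 'I_h = g @: 'I_h -> f = g.
Proof.
move=> /increasingP incf /increasingP incg fg.
have sm (u : {ffun 'I_h -> 'I_n}) : (forall a b : 'I_h, a < b -> u a < u b) ->
    sorted (fun x y : 'I_n => x < y) (map u (enum 'I_h)).
  by move=> uinc; apply: homo_sorted (sorted_enum_ord _) => a b; exact: uinc.
have E : map f (enum 'I_h) = map g (enum 'I_h).
  apply: (@irr_sorted_eq _ (fun x y : 'I_n => x < y)).
  - by move=> x y z; exact: ltn_trans.
  - by move=> x; rewrite /= ltnn.
  - exact: sm.
  - exact: sm.
  - have im (u : {ffun 'I_h -> 'I_n}) x : (x \in map u (enum 'I_h)) = (x \in u @: 'I_h).
      apply/mapP/imsetP => [[a _ ->]|[a _ ->]]; exists a => //.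
      by rewrite mem_enum.
    by move=> x; rewrite !im fg.
apply/ffunP => a; move/eq_in_map: E; apply; exact: mem_enum.
Qed.

(** Taking images is a bijection onto the [h]-subsets of [B]; its inverse lists a subset in
    increasing order. *)
Lemma card_increasing_in (B : {set 'I_n}) :
  #|[set f : {ffun 'I_h -> 'I_n} | increasing f && [forall a : 'I_h, f a \in B]]| = 'C(#|B|, h).
Proof.
rewrite -cards_draws -(@card_in_imset _ _ (fun f : {ffun 'I_h -> 'I_n} => f @: 'I_h));
  last first.
  by move=> f g; rewrite !inE => /andP[incf _] /andP[incg _]; exact: increasing_inj.
apply: eq_card => A; apply/imsetP/idP => [[f]|].
  rewrite inE => /andP[/increasingP incf /forallP fB] ->.
  rewrite inE; apply/andP; split.
    by apply/fintype.subsetP => _ /imsetP[a _ ->].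
  rewrite card_imset ?card_ord //.
  move=> a b ab; apply/val_inj/eqP; rewrite eqn_leq.
  case: (ltngtP a b) => // /incf; rewrite ab ltnn //.
rewrite inE => /andP[/fintype.subsetP AB /eqP Ah].
pose f := [ffun a : 'I_h => enum_val (cast_ord (esym Ah) a)].
exists f.
  rewrite inE; apply/andP; split.
    apply/increasingP => a b ab; rewrite !ffunE.
    pose x0 : 'I_n := f a.
    rewrite !(enum_val_nth x0).
    apply: (sorted_ltn_nth (leT := fun x y : 'I_n => x < y)) => //.
    - by move=> x y z; exact: ltn_trans.
    - exact: sorted_enum_ord.
    - rewrite inE -cardE; exact: ltn_ord.
    - rewrite inE -cardE; exact: ltn_ord.
  by apply/forallP => a; rewrite ffunE; apply/AB/enum_valP.
apply/setP => x; apply/idP/imsetP => [xA|[a _ ->]]; last by rewrite ffunE; exact: enum_valP.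
exists (cast_ord Ah (enum_rank_in xA x)) => //.
by rewrite ffunE cast_ordK enum_rankK_in.
Qed.

End IncreasingMaps.

(** * Occurrences counted by their last letter *)

Lemma decr_then_maxE h (a b : 'I_h.+1) :
  (decr_then_max h.+1 a < decr_then_max h.+1 b) =
  if b == h :> nat then (a < h) else (b < a < h).
Proof.
rewrite !permE /=; case: a b => a Ha [b Hb] /=.
by rewrite !eqSS; case: eqP => ?; case: eqP => ?; lia.
Qed.

(** Forgetting the last position turns an occurrence into an increasing map into [below p j].
    Conversely every such map has decreasing values, because an ascent followed by [p j] would be a
    123. *)
Lemma card_occurrences_at h n (p : 'S_n) (j : 'I_n) : avoids pattern123 p ->
  #|[set i : {ffun 'I_h.+1 -> 'I_n} |
      is_occurrence (decr_then_max h.+1) p i && (i ord_max == j)]| = 'C(#|below p j|, h).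
Proof.
move=> /avoids123P av; rewrite -card_increasing_in.
pose res (i : {ffun 'I_h.+1 -> 'I_n}) : {ffun 'I_h -> 'I_n} := [ffun a : 'I_h => i (lift ord_max a)].
have lm (a : 'I_h) : (lift ord_max a : nat) = a by rewrite lift_max.
rewrite -(@card_in_imset _ _ res); last first.
  move=> i i'; rewrite !inE => /andP[_ /eqP ij] /andP[_ /eqP ij'] E.
  apply/ffunP => a; case: (unliftP ord_max a) => [b ->|->]; last by rewrite ij ij'.
  by move/ffunP: E => /(_ b); rewrite !ffunE.
apply: eq_card => f; apply/imsetP/idP => [[i]|].
  rewrite !inE => /andP[/andP[/forallP inc /forallP ord] /eqP ij] ->.
  apply/andP; split.
    apply/increasingP => a b ab; rewrite !ffunE.
    by move/forallP: (inc (lift ord_max a)) => /(_ (lift ord_max b)) /implyP; apply; rewrite !lm.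
  apply/forallP => a; rewrite ffunE inE -ij; apply/andP; split.
    by move/forallP: (inc (lift ord_max a)) => /(_ ord_max) /implyP; apply; rewrite lm /=.
  move/forallP: (ord (lift ord_max a)) => /(_ ord_max) /eqP ->.
  by rewrite decr_then_maxE eqxx lm ltn_ord.
rewrite inE => /andP[/increasingP inc /forallP fB].
pose i : {ffun 'I_h.+1 -> 'I_n} := [ffun a => if unlift ord_max a is Some b then f b else j].
have il b : i (lift ord_max b) = f b by rewrite ffunE liftK.
have im : i ord_max = j by rewrite ffunE unlift_none.
have fj b : f b < j /\ p (f b) < p j by move: (fB b); rewrite inE => /andP[].
have dec (a b : 'I_h) : a < b -> p (f b) < p (f a).
  move=> ab; rewrite ltnNge; apply/negP => pab.
  apply: (av (f a) (f b) j (inc _ _ ab) (proj1 (fj b)) _ (proj2 (fj b))).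
  rewrite ltn_neqAle pab andbT; apply/eqP => /val_inj/perm_inj E.
  by move: (inc _ _ ab); rewrite E ltnn.
exists i; last by apply/ffunP => a; rewrite ffunE il.
rewrite inE im eqxx andbT; apply/andP; split; apply/forallP => a; apply/forallP => b.
  case: (unliftP ord_max a) => [a' ->|->]; case: (unliftP ord_max b) => [b' ->|->].
  - by rewrite !il !lm; apply/implyP/inc.
  - by rewrite il im; apply/implyP => _; case: (fj a').
  - by rewrite lm /= ltnNge ltnW.
  - by rewrite ltnn.
rewrite decr_then_maxE; case: (unliftP ord_max a) => [a' ->|->]; case: (unliftP ord_max b) => [b' ->|->].
- rewrite !il !lm ltn_ord andbT (ltn_eqF (ltn_ord b')).
  case: (ltngtP a' b') => [ab|ba|/val_inj ->]; last by rewrite ltnn.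
  + by rewrite ltnNge ltnW // dec.
  + by rewrite dec.
- by rewrite il im eqxx lm ltn_ord; case: (fj a') => _ ->.
- rewrite il im lm (ltn_eqF (ltn_ord b')) ltnn andbF.
  by rewrite ltnNge ltnW //; case: (fj b').
- by rewrite im eqxx !ltnn.
Qed.

Lemma occurrences_decr_then_max h n (p : 'S_n) : avoids pattern123 p ->
  occurrences (decr_then_max h.+1) p = \sum_(j < n) 'C(#|below p j|, h).
Proof.
move=> av; rewrite /occurrences -sum1_card.
rewrite (partition_big (fun i : {ffun 'I_h.+1 -> 'I_n} => i ord_max) predT) //=.
apply: eq_bigr => j _; rewrite -(card_occurrences_at h j av) -sum1_card.
by apply: eq_bigl => i; rewrite !inE.
Qed.

(** * Appending a last entry *)

(** [lift_perm ord_max a s] appends the value [a] to [s] and raises the values of [s] from [a] on by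
    one. It is injective between sets of equal size. *)
Lemma sum_lift_perm n (G : 'S_n.+1 -> nat) :
  \sum_(p : 'S_n.+1) G p = \sum_(a < n.+1) \sum_(s : 'S_n) G (lift_perm ord_max a s).
Proof.
rewrite pair_big /=.
pose f (x : 'I_n.+1 * 'S_n) := lift_perm ord_max x.1 x.2.
rewrite (reindex f) //; apply/onW_bij/inj_card_bij; last first.
  by rewrite card_prod !card_Sn card_ord factS.
move=> [a s] [b t] /= E.
have ab : a = b by move/permP: E => /(_ ord_max); rewrite !lift_perm_id.
congr pair => //; apply/permP => i; move/permP: E => /(_ (lift ord_max i)).
by rewrite !lift_perm_lift ab => /lift_inj.
Qed.

Section LastEntry.

Variables (n : nat) (a : 'I_n.+1) (s : 'S_n).

Local Notation p := (lift_perm ord_max a s).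
Local Notation wid := (lift ord_max).

Lemma lift_ltn (i j : 'I_n) : (lift a i < lift a j) = (i < j).
Proof. by rewrite /= /bump; lia. Qed.

Lemma lift_ltn_pivot (i : 'I_n) : (lift a i < a) = (i < a).
Proof. by rewrite /= /bump; lia. Qed.

Lemma card_below_lift (j : 'I_n) : #|below p (wid j)| = #|below s j|.
Proof.
rewrite -[RHS](card_imset _ (@lift_inj _ ord_max)); apply: eq_card => i.
rewrite inE; apply/idP/imsetP => [|[i' + ->]]; last first.
  by rewrite inE !lift_perm_lift lift_ltn !lift_max.
case: (unliftP ord_max i) => [i' ->|->].
  by rewrite !lift_perm_lift lift_ltn !lift_max => H; exists i' => //; rewrite inE.
by rewrite lift_max /= ltnNge (ltnW (ltn_ord j)).
Qed.

Lemma card_below_last : #|below p ord_max| = a.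
Proof.
pose f (v : 'I_a) : 'I_n.+1 := (p^-1)%g (widen_ord (ltnW (ltn_ord a)) v).
have finj : injective f by move=> u v /perm_inj /(congr1 val) /= /val_inj.
rewrite -[RHS]card_ord -(card_imset _ finj); apply: eq_card => i.
rewrite inE lift_perm_id; apply/idP/imsetP => [/andP[_ ia]|[v _ ->]].
  exists (Ordinal ia) => //; rewrite /f; apply: (@perm_inj _ p).
  by rewrite permKV; apply: val_inj.
rewrite permKV /= ltn_ord andbT ltn_neqAle leq_ord andbT.
apply/eqP => E; have : p (f v) = p ord_max by congr (p _); apply: val_inj.
by rewrite permKV lift_perm_id => /(congr1 val) /= va; move: (ltn_ord v); rewrite va ltnn.
Qed.

End LastEntry.

(** Says that a further last entry of relative value [b] exceeds no ascent top, hence completes no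
    123. *)
Definition no_ascent_below n (p : 'S_n) (b : nat) : bool :=
  [forall i : 'I_n, forall j : 'I_n, (i < j) ==> (p i < p j) ==> (b <= p j)].

Lemma no_ascent_belowP n (p : 'S_n) b :
  reflect (forall i j : 'I_n, i < j -> p i < p j -> b <= p j) (no_ascent_below p b).
Proof.
apply: (iffP forallP) => [H i j ij pij|H i].
  by move/forallP: (H i) => /(_ j) /implyP /(_ ij) /implyP; apply.
by apply/forallP => j; apply/implyP => ij; apply/implyP; exact: H.
Qed.

(* The largest relative value that a further last entry may take without
   completing an occurrence of 123. *)
Definition ascent_floor n (p : 'S_n) : nat := \max_(b < n.+1 | no_ascent_below p b) b.

(** The predicate holds at 0 and passes to smaller [b], so its maximum determines it within the
    range [b <= n] of that maximum. *)
Lemma ascent_floorP n (p : 'S_n) b : b <= n ->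
  no_ascent_below p b = (b <= ascent_floor p).
Proof.
move=> bn; apply/idP/idP => [H|H].
  by apply: (@leq_bigmax_cond _ (fun i : 'I_n.+1 => no_ascent_below p i) _ (Ordinal (n:=n.+1) (m:=b) bn)).
have H0 : no_ascent_below p (@ord0 n) by apply/no_ascent_belowP.
have [|c /no_ascent_belowP Hc E] := @eq_bigmax_cond _ (fun i : 'I_n.+1 => no_ascent_below p i) (fun i => i : nat).
  by apply/card_gt0P; exists ord0.
apply/no_ascent_belowP => i j ij pij; apply: leq_trans (Hc i j ij pij).
by rewrite -E.
Qed.

Lemma ascent_floor_le n (p : 'S_n) : ascent_floor p <= n.
Proof. by apply/bigmax_leqP => i _; rewrite -ltnS. Qed.

Lemma ascent_floor_unique n (p : 'S_n) m : m <= n ->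
  (forall b, b <= n -> no_ascent_below p b = (b <= m)) -> ascent_floor p = m.
Proof.
move=> mn H; apply/eqP; rewrite eqn_leq -H ?ascent_floor_le //.
by rewrite ascent_floorP ?leqnn ?ascent_floor_le //= -ascent_floorP // H.
Qed.

Lemma avoids_lift_perm n (a : 'I_n.+1) (s : 'S_n) :
  avoids pattern123 (lift_perm ord_max a s) =
  avoids pattern123 s && (a <= ascent_floor s).
Proof.
rewrite -ascent_floorP; last by rewrite -ltnS.
apply/avoids123P/andP => [H|[/avoids123P av /no_ascent_belowP na] i j l].
  split.
    apply/avoids123P => i j l ij jl sij sjl.
    by apply: (H (lift ord_max i) (lift ord_max j) (lift ord_max l));
      rewrite ?lift_perm_lift ?lift_ltn ?lift_max.
  apply/no_ascent_belowP => i j ij sij; rewrite leqNgt; apply/negP => sja.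
  apply: (H (lift ord_max i) (lift ord_max j) ord_max);
    by rewrite ?lift_perm_lift ?lift_perm_id ?lift_ltn ?lift_ltn_pivot ?lift_max /=.
have nmax (x : 'I_n) : (@ord_max n < lift ord_max x) = false.
  by rewrite lift_max /= ltnNge ltnW.
case: (unliftP ord_max i) => [i' ->|->]; case: (unliftP ord_max j) => [j' ->|->];
  case: (unliftP ord_max l) => [l' ->|->]; rewrite ?nmax ?ltnn //;
  rewrite ?lift_perm_lift ?lift_perm_id ?lift_ltn ?lift_ltn_pivot ?lift_max.
- exact: av.
- by move=> ij _ sij; rewrite ltnNge (na i' j').
Qed.

(** A new minimum creates no ascent and pushes every old ascent top up by one. A new entry [a > 0]
    is itself an ascent top, and the old tops, at least [a], move above it. *)
Lemma ascent_floor_lift_perm n (a : 'I_n.+1) (s : 'S_n) : a <= ascent_floor s ->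
  ascent_floor (lift_perm ord_max a s) =
  if a == 0 :> nat then (ascent_floor s).+1 else a.
Proof.
move=> am; have an : a <= n by rewrite -ltnS.
have := am; rewrite -ascent_floorP // => /no_ascent_belowP na.
apply: ascent_floor_unique.
  by case: ifP => _; [rewrite ltnS ascent_floor_le|exact: ltnW].
move=> b bn.
(* The first conjunct, with [b.-1], treats the old ascent tops, all raised by one; the second treats
   the new entry, a top exactly when [a > 0]. *)
have -> : no_ascent_below (lift_perm ord_max a s) b =
    no_ascent_below s b.-1 && ((0 < a) ==> (b <= a)).
  apply/no_ascent_belowP/andP => [H|[/no_ascent_belowP H1 H2] i j].
    split.
      apply/no_ascent_belowP => i j ij sij.
      have := H (lift ord_max i) (lift ord_max j).
      rewrite !lift_max !lift_perm_lift lift_ltn => /(_ ij sij).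
      by rewrite /= /bump; case: (a <= s j); lia.
    apply/implyP => a0; have := card_below_last a s.
    move: a0; case: (nat_of_ord a) => // c _ /esym E.
    have /card_gt0P[i] : 0 < #|below (lift_perm ord_max a s) ord_max| by rewrite -E.
    rewrite inE => /andP[i1 i2]; have := H i ord_max i1 i2.
    by rewrite lift_perm_id E card_below_last.
  case: (unliftP ord_max j) => [j' ->|->]; case: (unliftP ord_max i) => [i' ->|->];
    rewrite ?ltnn //.
  - rewrite !lift_max !lift_perm_lift lift_ltn => ij sij.
    move: (H1 _ _ ij sij) (na _ _ ij sij); rewrite /= /bump => ? ->; lia.
  - by rewrite lift_max /= ltnNge ltnW.
  - rewrite lift_perm_lift lift_perm_id => _ ia; move/implyP: H2; apply.
    exact: leq_ltn_trans (leq0n _) ia.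
rewrite ascent_floorP; last lia.
by case: eqP => [->|]; lia.
Qed.

(* [walks h r s n] counts continuations by n further entries, making r more
   occurrences, of a 123-avoiding permutation whose [ascent_floor] is [s]. *)
Fixpoint walks (h r s n : nat) : nat :=
  if n is n'.+1 then
    \sum_(a < s.+1) if 'C(a, h) <= r
                    then walks h (r - 'C(a, h)) (if a == 0 :> nat then s.+1 else a) n'
                    else 0
  else r == 0.

Lemma walksS h r s n : walks h r s n.+1 =
  \sum_(0 <= a < s.+1) if 'C(a, h) <= r
                  then walks h (r - 'C(a, h)) (if a == 0 then s.+1 else a) n
                  else 0.
Proof. by rewrite big_mkord. Qed.

(** Interpolates between permutations of length [n], at [m = 0], and walks from the empty
    permutation, at [n = 0]. *)
Definition weighted_walks h r n m : nat :=
  \sum_(p : 'S_n | avoids pattern123 p &&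
                   (occurrences (decr_then_max h.+1) p <= r))
     walks h (r - occurrences (decr_then_max h.+1) p) (ascent_floor p) m.

Lemma occurrences_lift_perm h n (a : 'I_n.+1) (s : 'S_n) :
  avoids pattern123 s -> a <= ascent_floor s ->
  occurrences (decr_then_max h.+1) (lift_perm ord_max a s) =
  occurrences (decr_then_max h.+1) s + 'C(a, h).
Proof.
move=> av am; rewrite !occurrences_decr_then_max ?avoids_lift_perm ?av //.
rewrite big_ord_recr /= card_below_last; congr addn; apply: eq_bigr => j _.
rewrite -(card_below_lift a); congr ('C(#|below _ _|, _)).
by apply: val_inj; rewrite /= /bump leqNgt ltn_ord.
Qed.

Lemma weighted_walks_shift h r n m :
  weighted_walks h r n.+1 m = weighted_walks h r n m.+1.
Proof.
rewrite /weighted_walks big_mkcond sum_lift_perm exchange_big /= [RHS]big_mkcond /=.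
apply: eq_bigr => s _; case: (boolP (avoids pattern123 s)) => [av|nav]; last first.
  by apply: big1 => a _; rewrite avoids_lift_perm (negbTE nav).
set o := occurrences _ s; set f := ascent_floor s.
have fn : f.+1 <= n.+1 by rewrite ltnS ascent_floor_le.
transitivity (\sum_(a < n.+1 | a < f.+1)
    if o + 'C(a, h) <= r
    then walks h (r - (o + 'C(a, h))) (if a == 0 :> nat then f.+1 else a) m else 0).
  rewrite [RHS]big_mkcond /=; apply: eq_bigr => a _.
  rewrite avoids_lift_perm av ltnS -/f; case: (leqP a f) => //= af.
  by rewrite occurrences_lift_perm // ascent_floor_lift_perm.
rewrite -(big_mkord (fun a => a < f.+1) (fun a => if o + 'C(a, h) <= r
    then walks h (r - (o + 'C(a, h))) (if a == 0 then f.+1 else a) m else 0)).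
rewrite -(big_nat_widen _ _ _ xpredT _ fn) big_mkord /=.
case: leqP => ro.
  apply: eq_bigr => a _; rewrite leq_subRL // subnDA //.
by apply: big1 => a _; rewrite leqNgt (leq_trans ro) // leq_addr.
Qed.

Lemma count_av123E h r n : count_av123 h.+1 r n = walks h r 0 n.
Proof.
have Z0 : weighted_walks h r n 0 = count_av123 h.+1 r n.
  rewrite /weighted_walks /count_av123 -sum1_card big_mkcond [RHS]big_mkcond /=.
  apply: eq_bigr => p _; rewrite inE /=; case: avoids => //=.
  by rewrite subn_eq0; case: ltngtP.
have shift m j : weighted_walks h r m j = weighted_walks h r 0 (m + j).
  by elim: m j => [//|m IH] j; rewrite weighted_walks_shift IH addSnnS.
rewrite -Z0 shift addn0 /weighted_walks.
have E (p : 'S_0) : (avoids pattern123 p = true) * (occurrences (decr_then_max h.+1) p = 0)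
    * (ascent_floor p = 0).
  have av : avoids pattern123 p by apply/avoids123P => -[].
  rewrite av occurrences_decr_then_max // big_ord0; split => //.
  by apply/eqP; rewrite -leqn0 ascent_floor_le.
rewrite (eq_bigr (fun=> walks h r 0 n)) => [|p _]; last by rewrite !E subn0.
rewrite sum_nat_cond_const; set c := #|_|; suff -> : c = 1 by rewrite mul1n.
rewrite /c -[RHS]/(0`!) -(card_Sn 0); apply: eq_card => p.
by rewrite !inE !E.
Qed.

Lemma walks_first h r n : 0 < h -> walks h r 0 n.+1 = walks h r 1 n.
Proof. by move=> h0; rewrite walksS big_nat1 bin0n gtn_eqF //= subn0. Qed.

(** The landings at heights 1 to [s] are common to both starts; the climbs and the landing at [s.+1]
    remain. The additive form avoids truncated subtraction. *)
Lemma walks_diff h r s n : 0 < h ->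
  walks h r s.+1 n.+1 + walks h r s.+1 n =
  walks h r s n.+1 + walks h r s.+2 n +
  (if 'C(s.+1, h) <= r then walks h (r - 'C(s.+1, h)) s.+1 n else 0).
Proof.
move=> h0; rewrite !walksS big_nat_recr //= big_ltn // [in RHS]big_ltn //=.
rewrite bin0n gtn_eqF //= subn0.
set X := \sum_(1 <= i < s.+1) _; set Y := \sum_(1 <= i < s.+1) _.
have -> : X = Y by apply: eq_big_nat => -[].
lia.
Qed.

Lemma count_av123_singleton r n : r < n -> count_av123 1 r n = 0.
Proof.
move=> rn; apply/eqP; rewrite cards_eq0; apply/eqP/setP => p; rewrite !inE.
apply/negbTE/negP => /andP[av].
rewrite occurrences_decr_then_max // (eq_bigr (fun=> 1)) => [|j _]; last by rewrite bin0.
by rewrite sum1_card card_ord gtn_eqF.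
Qed.

Local Open Scope classical_set_scope.
Local Open Scope ring_scope.

(** * Paths on the path graph *)

Section PathCount.

Variables (R : realType) (k : nat).

Definition angle : R := pi / k.+1%:R.

Lemma angle_k1 : k.+1%:R * angle = pi :> R.
Proof. by rewrite /angle mulrC divfK ?pnatr_eq0. Qed.

(** The eigenvalue is squared because one unit of [n] amounts to two steps on the path graph. *)
Definition lead : R := (2 * cos angle) ^+ 2.

(* The number of paths of length L from s to t on the path graph with vertices
   1, ..., k, written in the eigenbasis of its adjacency matrix; it vanishes at
   s = 0 and s = k + 1. *)
Definition paths (L s t : nat) : R :=
  2 / k.+1%:R * \sum_(1 <= j < k.+1)
    sin (s%:R * (j%:R * angle)) * sin (t%:R * (j%:R * angle)) * (2 * cos (j%:R * angle)) ^+ L.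

Lemma paths0s L t : paths L 0 t = 0.
Proof.
by rewrite /paths big1_seq ?mulr0 // => j _; rewrite mul0r sin0 !mul0r.
Qed.

Lemma sin_npi (j : nat) : sin (j%:R * pi) = 0 :> R.
Proof. by elim: j => [|j IH]; rewrite ?mul0r ?sin0 // -natr1 mulrDl mul1r sinDpi IH oppr0. Qed.

Lemma cos_npi (j : nat) : cos (j%:R * pi) = (-1) ^+ j :> R.
Proof. by elim: j => [|j IH]; rewrite ?mul0r ?cos0 // -natr1 mulrDl mul1r cosDpi IH exprS mulN1r. Qed.

Lemma pathsk1 L t : paths L k.+1 t = 0.
Proof.
rewrite /paths big1_seq ?mulr0 // => j _.
by rewrite mulrCA angle_k1 sin_npi !mul0r.
Qed.

(** For each eigenvector, [2 cos x sin ((s+1) x) = sin (s x) + sin ((s+2) x)]. *)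
Lemma pathsS L s t : paths L.+1 s.+1 t = paths L s t + paths L s.+2 t.
Proof.
rewrite /paths -mulrDr -big_split /=; congr (_ * _); apply: eq_bigr => j _.
set x := j%:R * angle; set y := sin (t%:R * x); rewrite exprS.
have -> : s%:R * x = s.+1%:R * x - x by rewrite -natr1 mulrDl mul1r addrK.
have -> : s.+2%:R * x = s.+1%:R * x + x by rewrite -[s.+2%:R]natr1 mulrDl mul1r.
rewrite sinB sinD; ring.
Qed.

Lemma sin_angle_gt0 (j : nat) : (0 < j)%N -> (j < k.+1)%N -> 0 < sin (j%:R * angle).
Proof.
move=> j0 jk; have a0 : 0 < angle by rewrite divr_gt0 ?pi_gt0 ?ltr0n.
apply: sin_gt0_pi; rewrite mulr_gt0 ?ltr0n //= -angle_k1 ltr_pM2r // ltr_nat //.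
Qed.

(** Multiplying by [2 sin y], with [y] half the angle increment, makes the sum telescope. The bounds
    on [m] keep [y] strictly between 0 and pi. *)
Lemma sum_cos_angle (m : nat) : (0 < m)%N -> (m < k.+1 + k.+1)%N ->
  \sum_(0 <= j < k.+1) cos (m%:R * (j%:R * angle)) = (1 - (-1) ^+ m) / 2.
Proof.
move=> m0 mk; set y : R := m%:R * angle / 2.
have y0 : 0 < sin y.
  have a0 : 0 < angle by rewrite divr_gt0 ?pi_gt0 ?ltr0n.
  apply: sin_gt0_pi; apply/andP; split; first by rewrite divr_gt0 // (mulr_gt0 _ a0) ?ltr0n.
  rewrite ltr_pdivrMr // -angle_k1 mulrAC ltr_pM2r // -natrM ltr_nat; lia.
have tel n : 2 * sin y * \sum_(0 <= j < n) cos (m%:R * (j%:R * angle)) =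
    sin (m%:R * (n%:R * angle) - y) + sin y.
  elim: n => [|n IH]; first by rewrite big_geq // mulr0 mul0r mulr0 sub0r sinN addNr.
  rewrite big_nat_recr //= mulrDr IH.
  have -> : m%:R * (n.+1%:R * angle) - y = m%:R * (n%:R * angle) + y.
    by rewrite -natr1 /y; field.
  rewrite sinB sinD; ring.
have : 2 * sin y != 0 by rewrite gt_eqF // mulr_gt0.
move=> /mulfI; apply; rewrite tel angle_k1 sinB sin_npi cos_npi; field => //.
Qed.

(** Orthogonality of the eigenvectors. Product-to-sum leaves cosine sums at [s - t] and [s + t];
    these have equal parity, so the sums cancel unless [s = t]. *)
Lemma paths_init (s t : nat) : (0 < s <= k)%N -> (0 < t <= k)%N ->
  paths 0 s t = (s == t)%:R.
Proof.
wlog ts : s t / (t <= s)%N => [H Hs Ht|].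
  case: (leqP t s) => [/H->//|st]; rewrite eq_sym -H // 1?ltnW //.
  by rewrite /paths; congr (_ * _); apply: eq_bigr => j _; rewrite [X in X * _ = _]mulrC.
move=> /andP[s0 sk] /andP[t0 tk].
have -> : paths 0 s t = (\sum_(0 <= j < k.+1) cos ((s - t)%:R * (j%:R * angle)) -
    \sum_(0 <= j < k.+1) cos ((s + t)%:R * (j%:R * angle))) / k.+1%:R.
  have -> : \sum_(0 <= j < k.+1) cos ((s - t)%:R * (j%:R * angle)) -
      \sum_(0 <= j < k.+1) cos ((s + t)%:R * (j%:R * angle)) =
      \sum_(0 <= j < k.+1) 2 * (sin (s%:R * (j%:R * angle)) * sin (t%:R * (j%:R * angle))).
    rewrite -sumrB; apply: eq_bigr => j _.
    rewrite natrB // natrD mulrBl mulrDl cosB cosD; ring.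
  rewrite big_ltn // mul0r mulr0 sin0 mul0r mulr0 add0r -mulr_sumr /paths mulrAC.
  by congr (_ * _ / _); apply: eq_bigr => j _; rewrite expr0 mulr1.
have k0 : k.+1%:R != 0 :> R by rewrite pnatr_eq0.
rewrite [X in _ - X]sum_cos_angle; [|lia|lia].
case: eqP => [->|/eqP st].
  rewrite subnn.
  have -> : (-1) ^+ (t + t) = 1 :> R by rewrite addnn -signr_odd odd_double.
  rewrite subrr mul0r subr0 (eq_bigr (fun=> 1)) => [|j _]; last by rewrite mul0r cos0.
  by rewrite sumr_const_nat subn0 divff.
rewrite sum_cos_angle; [|lia|lia].
have -> : (-1) ^+ (s + t) = (-1) ^+ (s - t) :> R.
  by rewrite -signr_odd -[RHS]signr_odd; congr (_ ^+ nat_of_bool _); lia.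
by rewrite subrr mul0r.
Qed.

(** Vertex 1 is more than [L] steps away. *)
Lemma paths_init_lt (L s : nat) : (0 < k)%N -> (L.+1 < s <= k.+1)%N -> paths L s 1 = 0.
Proof.
move=> k0; elim: L s => [|L IH] s /andP[Ls sk]; (have [->|] := eqVneq s k.+1; first exact: pathsk1) => sk1.
  by rewrite paths_init; [case: eqP Ls => // ->|lia|lia].
case: s Ls sk sk1 => // s Ls sk sk1; rewrite pathsS !IH ?addr0 //; lia.
Qed.

Lemma paths_start (s : nat) : (s < k)%N -> paths s s.+1 1 = 1.
Proof.
elim: s => [|s IH] sk; first by rewrite paths_init //; lia.
by rewrite pathsS IH ?paths_init_lt ?addr0 //; lia.
Qed.

End PathCount.

(** * Sequences with polynomial asymptotics *)

Lemma bin_addn_le (n d : nat) : ('C(n + d, d) <= n.+1 ^ d)%N.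
Proof.
elim: d => [|d IH]; first by rewrite bin0.
rewrite -(leq_pmul2l (ltn0Sn d)) -mul_bin_diag addnS /= expnS mulnA.
apply: leq_mul IH; nia.
Qed.

Lemma sum_bin_addn (n d : nat) :
  (\sum_(0 <= m < n.+1) 'C(m + d, d) = 'C(n + d.+1, d.+1))%N.
Proof.
elim: n => [|n IH]; first by rewrite big_nat1 !add0n !binn.
by rewrite big_nat_recr //= IH [in RHS]addSn binS addSnnS.
Qed.

Section Asymptotics.

Variable R : realType.
Implicit Types (f g : nat -> R) (c : R).

(* The main term is normalised by 'C(n + d, d), the coefficient of
   (1 - x)^-(d+1), so that convolution multiplies leading constants exactly. *)
Definition asymp (d : nat) c f : Prop :=
  exists K rho : R, [/\ 0 <= K, 0 < rho, rho < 1 & forall n : nat,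
    `|f n - c * 'C(n + d, d)%:R| <= K * (if d is d'.+1 then n.+1%:R ^+ d' else rho ^+ n)].

Lemma asymp_ext d c f g : f =1 g -> asymp d c f -> asymp d c g.
Proof.
move=> fg [K [rho [K0 r0 r1 H]]]; exists K, rho; split => // n; rewrite -fg; exact: H.
Qed.

Lemma asympD d c c' f g : asymp d c f -> asymp d c' g ->
  asymp d (c + c') (fun n => f n + g n).
Proof.
move=> [K [rho [K0 r0 r1 H]]] [K' [rho' [K0' r0' r1' H']]].
exists (K + K'), (Num.max rho rho'); split.
- exact: addr_ge0.
- by rewrite lt_max r0.
- by rewrite gt_max r1.
move=> n; rewrite mulrDl opprD addrACA mulrDl; apply: le_trans (ler_normD _ _) _.
apply: lerD; [apply: le_trans (H n) _|apply: le_trans (H' n) _]; apply: ler_wpM2l => //;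
  case: d {H H'} => //; apply: lerXn2r;
  by rewrite ?nnegrE ?le_max ?(ltW r0) ?(ltW r0') ?lexx ?orbT.
Qed.

Lemma asympZ a d c f : asymp d c f -> asymp d (a * c) (fun n => a * f n).
Proof.
move=> [K [rho [K0 r0 r1 H]]]; exists (`|a| * K), rho; split => //; first exact: mulr_ge0.
by move=> n; rewrite -mulrA -mulrBr normrM -mulrA; apply: ler_wpM2l.
Qed.

Lemma asymp_cst c : asymp 0 c (fun=> c).
Proof.
exists 0, 2^-1; split => //; [by rewrite invf_lt1 // ltr1n|move=> n].
by rewrite bin0 mulr1 subrr normr0 mul0r.
Qed.

Lemma asymp0 d : asymp d 0 (fun=> 0).
Proof.
exists 0, 2^-1; split => //; [by rewrite invf_lt1 // ltr1n|move=> n].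
by rewrite mul0r subrr normr0 mul0r.
Qed.

Lemma asymp_geometric a mu : `|mu| < 1 -> asymp 0 0 (fun n => a * mu ^+ n).
Proof.
move=> mu1; exists `|a|, ((1 + `|mu|) / 2); split => //.
- lra.
move=> n; rewrite mul0r subr0 normrM normrX; apply: ler_wpM2l => //.
by apply: lerXn2r; rewrite ?nnegrE //; lra.
Qed.

Lemma bin_addn_ler (n d : nat) : 'C(n + d, d)%:R <= n.+1%:R ^+ d :> R.
Proof. by rewrite -natrX ler_nat bin_addn_le. Qed.

Lemma asymp_bound d c f : asymp d c f ->
  exists2 K : R, 0 <= K & forall n, `|f n| <= K * n.+1%:R ^+ d.
Proof.
move=> [K [rho [K0 r0 r1 H]]]; exists (K + `|c|); first exact: addr_ge0.
move=> n; rewrite -[f n](subrK (c * 'C(n + d, d)%:R)) mulrDl.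
apply: le_trans (ler_normD _ _) _; apply: lerD.
  apply: le_trans (H n) _; apply: ler_wpM2l => //; case: (d) => [|d'].
    by rewrite expr0 exprn_ile1 // ltW.
  by rewrite exprS ler_peMl ?exprn_ge0 // ler1n.
by rewrite normrM ler_wpM2l // ger0_norm // bin_addn_ler.
Qed.

Lemma asympS d c f : asymp d c f -> asymp d.+1 0 f.
Proof.
move=> /asymp_bound[K K0 H]; exists K, 2^-1; split => //.
  by rewrite invf_lt1 // ltr1n.
by move=> n; rewrite mul0r subr0.
Qed.

Lemma asymp_lt d d' c f : (d < d')%N -> asymp d c f -> asymp d' 0 f.
Proof.
move=> /subnKC <-; elim: (d' - d.+1)%N => [|m IH] H; first by rewrite addn0; apply: asympS H.
by rewrite addnS; apply: asympS (IH H).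
Qed.

Lemma asymp_tail1 c f : asymp 0 c (fun n => f n.+1) -> asymp 0 c f.
Proof.
move=> [K [rho [K0 r0 r1 H]]]; exists (`|f 0%N - c| + K / rho), rho; split => //.
  by rewrite addr_ge0 ?divr_ge0 // ltW.
case=> [|n]; first by rewrite bin0 mulr1 expr0 mulr1 lerDl divr_ge0 // ltW.
rewrite mulrDl; apply: ler_wpDl; first by rewrite mulr_ge0 // exprn_ge0 // ltW.
have -> : K / rho * rho ^+ n.+1 = K * rho ^+ n by rewrite exprS mulrA divfK // gt_eqF.
by have := H n; rewrite !bin0.
Qed.

Lemma asymp_tail m c f : asymp 0 c (fun n => f (n + m)%N) -> asymp 0 c f.
Proof.
elim: m => [|m IH] H; first by apply: asymp_ext H => n; rewrite addn0.
by apply/IH/asymp_tail1; apply: asymp_ext H => n; rewrite addnS.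
Qed.

Definition delay f (n : nat) : R := if n is n'.+1 then f n' else 0.

(** In positive degree, Pascal's rule shows that the delay changes the main term by a binomial of
    one degree less, which the error absorbs. *)
Lemma asymp_delay d c f : asymp d c f -> asymp d c (delay f).
Proof.
case: d => [|d]; first by move=> H; apply: asymp_tail1.
move=> [K [rho [K0 r0 r1 H]]]; exists (K + `|c|), rho; split => //; first exact: addr_ge0.
case=> [|n] /=.
  by rewrite add0n binn mulr1 sub0r normrN expr1n mulr1 lerDr.
have -> : f n - c * 'C(n.+1 + d.+1, d.+1)%:R =
    (f n - c * 'C(n + d.+1, d.+1)%:R) - c * 'C(n.+1 + d, d)%:R.
  by rewrite addSn binS natrD addSnnS; ring.
rewrite mulrDl; apply: le_trans (ler_normB _ _) _; apply: lerD.
  apply: le_trans (H n) _; apply: ler_wpM2l => //.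
  by apply: lerXn2r; rewrite ?nnegrE ?ler_nat.
by rewrite normrM ler_wpM2l // ger0_norm // bin_addn_ler.
Qed.

Lemma sum_geometric_le (rho : R) (n : nat) : 0 < rho -> rho < 1 ->
  \sum_(0 <= i < n) rho ^+ i <= (1 - rho)^-1.
Proof.
move=> r0 r1; have r1' : 0 < 1 - rho by rewrite subr_gt0.
rewrite -[leRHS]mul1r ler_pdivlMr //.
have -> : (\sum_(0 <= i < n) rho ^+ i) * (1 - rho) = 1 - rho ^+ n.
  elim: n => [|n IH]; first by rewrite big_geq // mul0r expr0 subrr.
  by rewrite big_nat_recr //= mulrDl IH exprS; ring.
by rewrite gerBl exprn_ge0 // ltW.
Qed.

Definition conv f g (n : nat) : R := \sum_(0 <= m < n.+1) f m * g (n - m)%N.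

(** The hockey-stick identity sums the main terms. The error of [g] decays geometrically, so it is
    summable against [f] and costs no power of [n]. *)
Lemma asymp_conv d c c' f g : asymp d c f -> asymp 0 c' g ->
  asymp d.+1 (c * c') (conv f g).
Proof.
move=> Hf; have [Kf Kf0 Bf] := asymp_bound Hf.
move: Hf => [K [rho [K0 r0 r1 H]]] [K' [rho' [K0' r0' r1' H']]].
have g0 : 0 <= (1 - rho)^-1 by rewrite invr_ge0 subr_ge0 ltW.
have g0' : 0 <= (1 - rho')^-1 by rewrite invr_ge0 subr_ge0 ltW.
exists (`|c'| * (K * (1 + (1 - rho)^-1)) + Kf * (K' * (1 - rho')^-1)), rho; split => //.
  by rewrite !(addr_ge0, mulr_ge0).
move=> n; rewrite -sum_bin_addn natr_sum mulr_sumr -sumrB.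
rewrite (eq_bigr (fun m => c' * (f m - c * 'C(m + d, d)%:R) +
    f m * (g (n - m)%N - c'))) => [|m _]; last ring.
rewrite big_split /= -mulr_sumr mulrDl; apply: le_trans (ler_normD _ _) _; apply: lerD.
  rewrite normrM -mulrA; apply: ler_wpM2l => //.
  apply: le_trans (ler_norm_sum _ _ _) _; apply: le_trans (ler_sum _ (fun m _ => H m)) _.
  rewrite -mulr_sumr -mulrA; apply: ler_wpM2l => //; case: (d) => [|d'].
    by rewrite expr0 mulr1 ler_wpDl // sum_geometric_le.
  apply: (@le_trans _ _ (\sum_(0 <= m < n.+1) n.+1%:R ^+ d')).
    apply: ler_sum_nat => m /andP[_ mn]; apply: lerXn2r; by rewrite ?nnegrE ?ler_nat.
  rewrite sumr_const_nat subn0 -[leLHS]mulr_natl -exprS ler_peMl ?exprn_ge0 //.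
  by rewrite lerDl.
apply: le_trans (ler_norm_sum _ _ _) _.
apply: (@le_trans _ _ (\sum_(0 <= m < n.+1) Kf * n.+1%:R ^+ d * (K' * rho' ^+ (n - m)))).
  apply: ler_sum_nat => m /andP[_ mn]; rewrite normrM; apply: ler_pM => //.
    apply: le_trans (Bf m) _; apply: ler_wpM2l => //.
    by apply: lerXn2r; rewrite ?nnegrE ?ler_nat.
  by have := H' (n - m)%N; rewrite bin0 mulr1.
rewrite -mulr_sumr mulrAC -!mulrA; apply: ler_wpM2l => //.
rewrite [leRHS]mulrA; apply: ler_wpM2r; first exact: exprn_ge0.
rewrite -mulr_sumr; apply: ler_wpM2l => //.
rewrite big_nat_rev /= add0n.
rewrite (eq_big_nat _ _ (F2 := fun m => rho' ^+ m)) => [|m /andP[_ mn]].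
  exact: sum_geometric_le.
by congr (_ ^+ _); lia.
Qed.

End Asymptotics.

(** * Asymptotics of the walk counts *)

Section Representation.

Variables (R : realType) (g : nat).

Local Notation h := g.+1.
Local Notation k := g.+2.
Local Notation paths := (@paths R k).

(* Paths reaching the end k of the path graph; the length is cut off at 0 by
   hand since natural subtraction would not return an empty count. *)
Definition exits (s n : nat) : R :=
  if (h <= 2 * n + 1 + s)%N then paths (2 * n + 1 + s - h) s k else 0.

Lemma exits_bottom n : exits 0 n = 0.
Proof. by rewrite /exits paths0s; case: ifP. Qed.

Lemma exits_top n : exits h.+1 n = exits h n.
Proof.
rewrite /exits !ifT; [|lia|lia].
have -> : (2 * n + 1 + h.+1 - h)%N = (2 * n + 1).+1 by lia.
by rewrite pathsS pathsk1 addr0; congr (paths _ _ _); lia.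
Qed.

Lemma exits_init s : (0 < s <= h)%N -> exits s 0 = (s == h)%:R.
Proof.
move=> sh; rewrite /exits; have [->|sn] := eqVneq s h.
  rewrite ifT; last lia.
  have -> : (2 * 0 + 1 + h - h = 1)%N by lia.
  rewrite pathsS [X in _ + X]paths_init ?eqxx; [|lia|lia].
  case: (posnP g) => [->|g0]; first by rewrite paths0s add0r.
  rewrite paths_init; [|lia|lia].
  by rewrite (_ : (g == k) = false) ?add0r //; lia.
case: ifP => // hs.
have -> : (2 * 0 + 1 + s - h = 0)%N by lia.
rewrite paths_init; [|lia|lia].
by rewrite (_ : (s == k) = false) //; lia.
Qed.

(** Both terms on the right prescribe a length one less than the left side, so this is the path
    recurrence. *)
Lemma exitsS s n : (s < h)%N -> exits s.+1 n.+1 = exits s n.+1 + exits s.+2 n.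
Proof.
move=> sh; rewrite /exits.
have -> : (2 * n.+1 + 1 + s = 2 * n + 3 + s)%N by lia.
have -> : (2 * n + 1 + s.+2 = 2 * n + 3 + s)%N by lia.
case: ifP => H1; case: ifP => H2; rewrite ?addr0 //; [| |lia].
- have -> : (2 * n.+1 + 1 + s.+1 - h = (2 * n + 3 + s - h).+1)%N by lia.
  exact: pathsS.
(* Both right terms are cut off; the left has length 0 and vanishes since [s.+1 < k]. *)
- have -> : (2 * n.+1 + 1 + s.+1 - h = 0)%N by lia.
  rewrite paths_init; [|lia|lia].
  by rewrite (_ : (s.+1 == k) = false) //; lia.
Qed.

Definition jump (r s n : nat) : R := (walks h r s.+1 n)%:R - (walks h r s n)%:R.

Lemma jump0 r s : jump r s 0 = 0.
Proof. by rewrite /jump /= subrr. Qed.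

Lemma jumpS r s n : jump r s n.+1 =
  jump r s.+1 n + (if ('C(s.+1, h) <= r)%N then walks h (r - 'C(s.+1, h)) s.+1 n else 0)%:R.
Proof.
rewrite /jump; set t := (if _ then _ else _).
have := congr1 (fun x => x%:R : R) (walks_diff r s n (ltn0Sn g)).
rewrite !natrD -/t; lra.
Qed.

(** For [s < h] a landing at height [s] creates nothing, so in [walks_diff] its term cancels against
    the left side. *)
Lemma walks_low r s n : (s < h)%N -> (walks h r s n.+1)%:R =
  (if s is s'.+1 then (walks h r s' n.+1)%:R else 0) + (walks h r s.+1 n)%:R :> R.
Proof.
case: s => [|s] sh; first by rewrite walks_first // add0r.
have := congr1 (fun x => x%:R : R) (walks_diff r s n (ltn0Sn g)).
rewrite bin_small // leq0n subn0 !natrD; lra.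
Qed.

(* Below height h the walk counts obey the path recurrence, forced at height g
   by [jump r g]; [duhamel s.+1] solves it for starting height s. *)
Section Duhamel.

Variable r : nat.

Definition duhamel (s n : nat) : R :=
  (r == 0%N)%:R * paths (2 * n + s).-1 s 1 +
  \sum_(0 <= m < n) jump r g m * exits s (n.-1 - m).

Lemma duhamel_bottom n : duhamel 0 n = 0.
Proof.
rewrite /duhamel paths0s mulr0 add0r big1_seq // => m _.
by rewrite exits_bottom mulr0.
Qed.

Lemma duhamel_top n : duhamel h.+1 n = duhamel h n.
Proof.
rewrite /duhamel; congr (_ * _ + _); last first.
  by apply: eq_bigr => m _; rewrite exits_top.
by rewrite !addnS /= pathsS pathsk1 addr0.
Qed.

Lemma duhamel_init s : (s < h)%N -> duhamel s.+1 0 = (r == 0%N)%:R.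
Proof.
by move=> sh; rewrite /duhamel big_geq // addr0 muln0 add0n /= paths_start ?mulr1 // ltnW.
Qed.

(** The convolution gains the summand [m = n], in which [exits s.+1 0] is 1 exactly for [s = g]; all
    else follows the path recurrence. *)
Lemma duhamelS s n : (s < h)%N ->
  duhamel s.+1 n.+1 = duhamel s n.+1 + duhamel s.+2 n + (s == g)%:R * jump r g n.
Proof.
move=> sh; rewrite /duhamel.
have -> : (2 * n.+1 + s.+1).-1 = (2 * n + s).+2 by lia.
have -> : (2 * n.+1 + s).-1 = (2 * n + s).+1 by lia.
have -> : (2 * n + s.+2).-1 = (2 * n + s).+1 by lia.
rewrite pathsS !big_nat_recr //= subnn exits_init; last lia.
have -> : exits s 0 = 0.
  case: (s) sh => [|s'] sh; first exact: exits_bottom.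
  by rewrite exits_init ?(ltn_eqF sh) //; lia.
have -> : \sum_(0 <= m < n) jump r g m * exits s.+1 (n - m) =
    \sum_(0 <= m < n) jump r g m * exits s (n - m) +
    \sum_(0 <= m < n) jump r g m * exits s.+2 (n.-1 - m).
  rewrite -big_split /=; apply: eq_big_nat => m /andP[_ mn].
  have -> : (n - m = (n.-1 - m).+1)%N by lia.
  by rewrite exitsS // mulrDr.
by rewrite eqSS; ring.
Qed.

(** At height [g] the recurrence refers to height [h], outside the range. That count is height [g],
    matched by [duhamel_top], plus [jump r g], matched by the source in [duhamelS]. *)
Lemma walks_duhamel s n : (s < h)%N -> (walks h r s n)%:R = duhamel s.+1 n.
Proof.
elim: n s => [|n IHn] s; first by move=> sh; rewrite duhamel_init.
elim: s => [|s IHs] sh.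
  rewrite walks_low // duhamelS // duhamel_bottom !add0r.
  case: (posnP g) => [g0|g0]; last first.
    by rewrite (ltn_eqF g0) mul0r addr0 IHn.
  have -> : duhamel 2 n = duhamel 1 n by have := duhamel_top n; rewrite g0.
  by rewrite -IHn // /jump g0 eqxx mul1r addrC subrK. 
rewrite walks_low // duhamelS // IHs; last exact: ltnW.
rewrite -[RHS]addrA; congr (_ + _).
have [sg|sg] := eqVneq s.+1 g; last first.
  by rewrite mul0r addr0 IHn //; lia.
by rewrite mul1r sg duhamel_top -IHn // addrC subrK.
Qed.

End Duhamel.

End Representation.

(** * Leading constants and induction on the number of occurrences *)

Section WalkAsymptotics.

Variables (R : realType) (g : nat).

Local Notation h := g.+1.
Local Notation k := g.+2.
Local Notation theta := (@angle R k).
Local Notation lam := (@lead R k).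

Lemma angle_gt0 : 0 < theta.
Proof. by rewrite divr_gt0 ?pi_gt0 ?ltr0n. Qed.

Lemma cos_angle_gt0 : 0 < cos theta.
Proof.
have t0 := angle_gt0; have kt := @angle_k1 R k.
apply: cos_gt0_pihalf; rewrite -kt; apply/andP; split.
  by rewrite (lt_le_trans _ (ltW t0)) // oppr_lt0 divr_gt0 // mulr_gt0.
rewrite ltr_pdivlMr // mulrC ltr_pM2r // ltr_nat //.
Qed.

Lemma lead_gt0 : 0 < lam.
Proof. by rewrite /lead exprn_gt0 // mulr_gt0 ?cos_angle_gt0. Qed.

Lemma lead_neq0 : lam != 0.
Proof. by rewrite gt_eqF // lead_gt0. Qed.

Lemma angle_bounds (j : nat) : (j <= k.+1)%N -> (j%:R * theta) \in `[0, pi].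
Proof.
move=> jk; rewrite in_itv /= -(@angle_k1 R k) mulr_ge0 ?ler0n ?(ltW angle_gt0) //=.
by rewrite ler_pM2r ?angle_gt0 // ler_nat.
Qed.

Lemma angle_sub (j : nat) : (j <= k.+1)%N -> (k.+1 - j)%:R * theta = pi - j%:R * theta.
Proof. by move=> jk; rewrite natrB // mulrBl angle_k1. Qed.

Lemma angle_top : k%:R * theta = pi - theta.
Proof. by have := @angle_sub 1 isT; rewrite subn1 mul1r. Qed.

Lemma cos_pi_sub (x : R) : cos (pi - x) = - cos x.
Proof. by rewrite cosB cospi sinpi; ring. Qed.

Lemma sin_pi_sub (x : R) : sin (pi - x) = sin x.
Proof. by rewrite sinB cospi sinpi; ring. Qed.

Lemma sin_npi_sub (n : nat) (x : R) : sin (n%:R * pi - x) = - ((-1) ^+ n * sin x).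
Proof. by rewrite sinB sin_npi cos_npi; ring. Qed.

(** Cosine decreases on [[0, pi]], so the inner eigenvalues lie strictly between the two extreme
    ones. *)
Lemma sub_lead (j : nat) : (1 < j < k)%N -> `|(2 * cos (j%:R * theta)) ^+ 2 / lam| < 1.
Proof.
move=> /andP[j1 jk]; have l0 := lead_gt0.
have c1 : cos (j%:R * theta) < cos theta.
  rewrite -[X in _ < cos X]mul1r ltr_cos ?(angle_bounds (j := 1)) ?angle_bounds //; last by lia.
  by rewrite ltr_pM2r ?angle_gt0 // ltr1n.
have c2 : - cos theta < cos (j%:R * theta).
  have -> : - cos theta = cos (k%:R * theta).
    by rewrite angle_top cos_pi_sub.
  rewrite ltr_cos ?angle_bounds //; last by lia.
  by rewrite ltr_pM2r ?angle_gt0 // ltr_nat.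
rewrite ger0_norm; last by rewrite divr_ge0 ?sqr_ge0 // ltW.
rewrite ltr_pdivrMr // mul1r /lead; nra.
Qed.

(** The eigenvalues at [j = 1] and [j = k] are opposite; the parity hypothesis makes their
    contributions equal. The others decay relative to [lam]. *)
Lemma asymp_paths (c s t : nat) : ~~ odd (s + t + c) ->
  asymp 0 (4 / k.+1%:R * (sin (s%:R * theta) * sin (t%:R * theta)) * (2 * cos theta) ^+ c)
    (fun n => paths R k (2 * n + c) s t / lam ^+ n).
Proof.
move=> ev; have l0 := lead_neq0; have k0 : k.+1%:R != 0 :> R by rewrite pnatr_eq0.
pose b (j : nat) : R := 2 / k.+1%:R * (sin (s%:R * (j%:R * theta)) * sin (t%:R * (j%:R * theta)))
   * (2 * cos (j%:R * theta)) ^+ c.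
have E n : paths R k (2 * n + c) s t / lam ^+ n =
    \sum_(1 <= j < k.+1) b j * ((2 * cos (j%:R * theta)) ^+ 2 / lam) ^+ n.
  rewrite /paths mulr_sumr mulr_suml; apply: eq_bigr => j _.
  by rewrite /b expr_div_n exprD exprM; ring.
have bk : b k = b 1%N.
  rewrite /b; have -> : k%:R * theta = pi - 1%:R * theta.
    by rewrite -angle_sub // subn1.
  rewrite !mulrBr !sin_npi_sub cos_pi_sub [2 * - _]mulrN [(- (2 * _)) ^+ c]exprNn.
  have : (-1) ^+ s * (-1) ^+ t * (-1) ^+ c = 1 :> R.
    by rewrite -!exprD -signr_odd (negbTE ev).
  set A := (-1) ^+ s; set B := (-1) ^+ t; set C := (-1) ^+ c => ABC.
  set x := sin _; set y := sin _; set z := (2 * _) ^+ c.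
  transitivity (2 / k.+1%:R * (x * y) * z * (A * B * C)); first by ring.
  by rewrite ABC mulr1.
have -> : 4 / k.+1%:R * (sin (s%:R * theta) * sin (t%:R * theta)) * (2 * cos theta) ^+ c =
    b 1%N + 0 + b 1%N.
  by rewrite /b mul1r; ring.
apply: (@asymp_ext _ _ _ (fun n => b 1%N +
   \sum_(2 <= j < k) b j * ((2 * cos (j%:R * theta)) ^+ 2 / lam) ^+ n + b 1%N)).
  move=> n; rewrite E [RHS]big_nat_recr //= [in RHS]big_ltn // bk; congr (_ + _ + _).
    by rewrite mul1r -/lam divff // expr1n mulr1.
  have -> : k%:R * theta = pi - 1%:R * theta by rewrite -angle_sub // subn1.
  by rewrite mul1r cos_pi_sub mulrN sqrrN -/lam divff // expr1n mulr1.
apply: asympD (asymp_cst _); apply: asympD (asymp_cst _) _.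
suff : forall m, (m <= k)%N ->
    asymp 0 0 (fun n => \sum_(2 <= j < m) b j * ((2 * cos (j%:R * theta)) ^+ 2 / lam) ^+ n).
  by apply.
elim=> [|m IH] mk.
  by apply: asymp_ext (asymp0 _ _) => n; rewrite big_geq.
case: (leqP 2 m) => m2; last by apply: asymp_ext (asymp0 _ _) => n; rewrite big_geq.
rewrite -[X in asymp _ X _]addr0; apply: asymp_ext (asympD (IH (ltnW mk)) (asymp_geometric (b m) (sub_lead _))).
  by move=> n; rewrite [RHS]big_nat_recr.
by rewrite m2.
Qed.

(** For [s <= g], the leading constant of walks without occurrences from height [s], that is, of
    paths of length [2 * n + s] from [s.+1] to 1. *)
Definition weight (s : nat) : R :=
  4 / k.+1%:R * (sin (s.+1%:R * theta) * sin theta) * (2 * cos theta) ^+ s.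

Definition gain : R := 4 * sin theta ^+ 2 / k.+1%:R / lam.

(** After a shift of [n] by [h] the cut-off is never active; the shift costs the factor
    [lam ^- h]. *)
Lemma asymp_exits (s : nat) :
  asymp 0 (weight s * (2 * cos theta) ^+ k.+1 / lam ^+ h) (fun n => exits R g s.+1 n / lam ^+ n).
Proof.
apply: (@asymp_tail _ h).
have ev : ~~ odd (s.+1 + k + (s + k.+1)) by lia.
have := asympZ (lam ^- h) (asymp_paths ev).
have -> : sin (k%:R * theta) = sin theta.
  by rewrite angle_top sin_pi_sub.
have -> : lam ^- h * (4 / k.+1%:R * (sin (s.+1%:R * theta) * sin theta) *
    (2 * cos theta) ^+ (s + k.+1)) = weight s * (2 * cos theta) ^+ k.+1 / lam ^+ h.
  by rewrite /weight exprD; ring.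
apply: asymp_ext => n; rewrite /exits ifT; last lia.
have -> : (2 * (n + h) + 1 + s.+1 - h = 2 * n + (s + k.+1))%N by lia.
by rewrite exprD invfM; ring.
Qed.

(** As [h] times [theta] is [pi - 2 theta], the double-angle formula supplies one more cosine. *)
Lemma weight_top : weight g = 4 * sin theta ^+ 2 / k.+1%:R * (2 * cos theta) ^+ h.
Proof.
have -> : weight g = 4 / k.+1%:R * (sin (h%:R * theta) * sin theta) * (2 * cos theta) ^+ g by [].
have -> : h%:R * theta = pi - 2%:R * theta by rewrite -angle_sub // subSS subSS subn0.
by rewrite sin_pi_sub [2%:R * theta]mulr_natl sin_mulr2n [(2 * cos theta) ^+ h]exprS; ring.
Qed.

(* After the first occurrence the walk restarts from height h, which behaves as
   height g; this is the factor gained per occurrence. *)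
Lemma weight_step (s : nat) :
  weight s * (2 * cos theta) ^+ k.+1 / lam ^+ h * weight g / lam ^+ 2 = weight s * gain.
Proof.
have l0 := lead_neq0.
have -> : weight s * (2 * cos theta) ^+ k.+1 / lam ^+ h * weight g / lam ^+ 2 =
  weight s * (4 * sin theta ^+ 2 / k.+1%:R) *
  (((2 * cos theta) ^+ k.+1 * (2 * cos theta) ^+ h) / (lam ^+ h * lam ^+ 2)).
  rewrite weight_top [(lam ^+ h * lam ^+ 2)^-1]invfM.
  move: (lam ^+ h)^-1 (lam ^+ 2)^-1 ((2 * cos theta) ^+ h) ((2 * cos theta) ^+ k.+1) => A B C D.
  by move: (4 * _ / _) => E; ring.
rewrite -exprD -exprD; have -> : (k.+1 + h = 2 * k)%N by lia.
rewrite exprM -/lam; have -> : lam ^+ k / lam ^+ (h + 2) = lam^-1.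
  by rewrite addn2 [lam ^+ g.+3]exprS invfM mulrCA divff ?mulr1 // (expf_neq0 k l0).
rewrite /gain; ring.
Qed.

Local Notation nwalks r s := (fun n => (walks h r s n)%:R / lam ^+ n).

(** Since ['C(h + m, h) > m], a landing above [s] already creates more than [r] occurrences, so no
    source ever arises. *)
Lemma jump_high (r s n : nat) : (g + r <= s)%N -> jump R g r s n = 0.
Proof.
elim: n s => [|n IH] s gs; first exact: jump0.
rewrite jumpS IH; last lia.
rewrite ifF ?addr0 //; apply/negbTE; rewrite -ltnNge.
have -> : s.+1 = (h + (s - g))%N by lia.
have : (s - g < 'C(h + (s - g), h))%N; last lia.
elim: (s - g)%N => [|m IHm]; first by rewrite addn0 binn.
by rewrite addnS binS; have := bin_gt0 (h + m) g; lia.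
Qed.

Lemma jump_normS (r s n : nat) : jump R g r s n / lam ^+ n =
  lam^-1 * delay (fun n => jump R g r s.+1 n / lam ^+ n +
    (if ('C(s.+1, h) <= r)%N then walks h (r - 'C(s.+1, h)) s.+1 n else 0)%:R / lam ^+ n) n.
Proof.
case: n => [|n] /=; first by rewrite jump0 mul0r mulr0.
by rewrite jumpS exprS invfM -mulrDl; ring.
Qed.

(** Landings above height [h] create at least two occurrences, so every source has degree at most
    [r - 2]. Descending induction on [s] starts at [g + r], where jumps vanish. *)
Lemma asymp_jump_high (r s : nat) :
  (forall r' s', (r' < r)%N -> exists c, asymp r' c (nwalks r' s')) ->
  (g < s)%N -> asymp r.-1 0 (fun n => jump R g r s n / lam ^+ n).
Proof.
move=> IH gs; have [d] : exists d, (g + r <= s + d)%N by exists (g + r)%N; lia.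
elim: d s gs => [|d IHd] s gs sd.
  by apply: asymp_ext (asymp0 _ _) => n; rewrite jump_high ?mul0r //; lia.
rewrite -[X in asymp _ X _](mulr0 lam^-1).
apply: asymp_ext (fsym (jump_normS r s)) _; apply/asympZ/asymp_delay.
rewrite -[X in asymp _ X _]addr0; apply: asympD; first by apply: IHd; lia.
case: leqP => Cr; last by apply: asymp_ext (asymp0 _ _) => n; rewrite mul0r.
have C2 : (1 < 'C(s.+1, h))%N.
  have Cg : (0 < 'C(s, g))%N by rewrite bin_gt0 ltnW.
  have Ch : (0 < 'C(s, h))%N by rewrite bin_gt0.
  by rewrite binS (leq_add Ch Cg).
have rC : (r - 'C(s.+1, h) < r)%N by lia.
have [c Hc] := IH _ s.+1 rC.
by apply: asymp_lt Hc; lia.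
Qed.

(** The landing at [h] creates exactly one occurrence and leaves [r]; the jump at [h] is of lower
    order. *)
Lemma asymp_jump (r : nat) c :
  (forall r' s', (r' < r.+1)%N -> exists c, asymp r' c (nwalks r' s')) ->
  asymp r c (nwalks r h) -> asymp r (c / lam) (fun n => jump R g r.+1 g n / lam ^+ n).
Proof.
move=> IH Hc; rewrite mulrC.
apply: asymp_ext (fsym (jump_normS r.+1 g)) _; apply/asympZ/asymp_delay.
rewrite -[X in asymp _ X _]add0r; apply: asympD; first exact: (@asymp_jump_high r.+1 h).
by rewrite binn /= subn1.
Qed.

(** Up to height [g], the Duhamel formula convolves [jump r g], known from smaller [r], with
    [exits], which raises the degree by one. Above [g] only jumps of lower order are added, hence
    the [minn]. *)
Lemma asymp_walks (r s : nat) : asymp r (weight (minn s g) * gain ^+ r) (nwalks r s).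
Proof.
elim/ltn_ind: r s => r IH s.
have IHex r' s' : (r' < r)%N -> exists c, asymp r' c (nwalks r' s').
  by move=> rr; exists (weight (minn s' g) * gain ^+ r'); exact: IH.
have low t : (t <= g)%N -> asymp r (weight t * gain ^+ r) (nwalks r t).
  move=> tg; case: r IH IHex => [|r] IH IHex.
    (* For [r = 0] the jump at [g] vanishes and only the homogeneous path term remains. *)
    rewrite expr0 mulr1.
    have ev : ~~ odd (t.+1 + 1 + t) by lia.
    have := asymp_paths ev; rewrite mul1r; apply: asymp_ext => n.
    rewrite walks_duhamel // /duhamel mul1r addnS /= big1_seq ?addr0 //.
    by move=> m _; rewrite jump_high ?mul0r // addn0.
  have HJ := asymp_jump IHex (IH r (ltnSn _) h).
  have := asympZ lam^-1 (asymp_delay (asymp_conv HJ (asymp_exits t))).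
  rewrite (minn_idPr (leqnSn g)).
  set c := (X in asymp _ X _ -> _); have -> : c = weight t * gain ^+ r.+1.
    rewrite [gain ^+ _]exprS mulrA -weight_step /c [lam ^+ 2]expr2 [(lam * lam)^-1]invfM.
    by move: (gain ^+ r) (lam^-1) (lam ^+ h)^-1 (_ ^+ k.+1) => A B C D; ring.
  apply: asymp_ext => n; rewrite walks_duhamel // /duhamel mul0r add0r.
  case: n => [|n] /=; first by rewrite big_geq // mul0r mulr0.
  rewrite /conv mulr_sumr mulr_suml; apply: eq_big_nat => m /andP[_ mn].
  have -> : lam ^+ n.+1 = lam * (lam ^+ m * lam ^+ (n - m)).
    by rewrite -exprD subnKC // exprS.
  rewrite [(lam * _)^-1]invfM [(lam ^+ m * _)^-1]invfM.
  by move: (lam^-1) (lam ^+ m)^-1 (lam ^+ (n - m))^-1 => A B C; ring.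
case: (leqP s g) => [sg|gs]; first by rewrite ?(minn_idPl sg); exact: low.
rewrite ?(minn_idPr (ltnW gs)).
(* Climb from [g] to [s] one height at a time; each jump contributes constant 0 in degree [r]. *)
rewrite -(subnKC (ltnW gs)); elim: (s - g)%N => [|m IHm].
  by rewrite addn0; exact: low.
rewrite -[X in asymp _ X _]addr0.
apply: (@asymp_ext _ _ _ (fun n => (walks h r (g + m) n)%:R / lam ^+ n +
    jump R g r (g + m) n / lam ^+ n)).
  by move=> n; rewrite -mulrDl /jump addnS addrC subrK.
apply: asympD IHm _.
case: r IH IHex low => [|r] IH IHex low.
  by apply: asymp_ext (asymp0 _ _) => n; rewrite jump_high ?mul0r // addn0 leq_addr.
case: m => [|m].
  by rewrite addn0; apply: asympS (asymp_jump IHex (IH r (ltnSn _) h)).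
by apply: asympS (asymp_jump_high IHex _); lia.
Qed.

End WalkAsymptotics.

(** * From additive to relative error *)

Section RelativeError.

Variable R : realType.

(** The quotient is the product of the factors [1 + i / n] for [i] from 1 to [d]. *)
Lemma fact_bin_addn_ratio (d : nat) : exists2 A : R, 0 <= A & forall n : nat, (0 < n)%N ->
  `|'C(n + d, d)%:R * d`!%:R / n%:R ^+ d - 1| <= A / n%:R.
Proof.
elim: d => [|d [A A0 IH]].
  by exists 0 => // n _; rewrite bin0 fact0 expr0 mulr1 divr1 subrr normr0 mul0r.
exists (A * d.+2%:R + d.+1%:R); first by rewrite addr_ge0 ?mulr_ge0.
move=> n n0; have n0' : 0 < n%:R :> R by rewrite ltr0n.
have nz : n%:R != 0 :> R by rewrite gt_eqF.
have E : 'C(n + d.+1, d.+1)%:R * (d.+1)`!%:R = 'C(n + d, d)%:R * d`!%:R * (n%:R + d.+1%:R) :> R.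
  rewrite -natrD -!natrM factS mulnA [X in (X * _)%N]mulnC -mul_bin_diag addnS /=.
  by congr (_%:R); lia.
have -> : 'C(n + d.+1, d.+1)%:R * (d.+1)`!%:R / n%:R ^+ d.+1 - 1 =
    ('C(n + d, d)%:R * d`!%:R / n%:R ^+ d - 1) * (1 + d.+1%:R / n%:R) + d.+1%:R / n%:R :> R.
  rewrite E exprS invfM; move: (_ * d`!%:R) (n%:R ^+ d)^-1 (d.+1%:R) => P Q D; field => //.
apply: le_trans (ler_normD _ _) _; rewrite [leRHS]mulrDl; apply: lerD; last first.
  by rewrite ger0_norm // divr_ge0.
rewrite normrM [leRHS]mulrAC; apply: ler_pM => //; first exact: IH.
rewrite ger0_norm ?addr_ge0 ?divr_ge0 // -[d.+2%:R]natr1 addrC lerD2r.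
by rewrite ler_pdivrMr // ler_peMr // ler1n.
Qed.

(** Each of the first [n] powers is at least [rho ^+ n], so [n] times it is below the geometric
    sum. *)
Lemma geometric_le_inv (rho : R) (n : nat) : 0 < rho -> rho < 1 -> (0 < n)%N ->
  rho ^+ n <= (1 - rho)^-1 / n%:R.
Proof.
move=> r0 r1 n0; rewrite ler_pdivlMr ?ltr0n // mulr_natr.
apply: le_trans (sum_geometric_le n r0 r1).
rewrite -[X in _ *+ X](subn0 n) -sumr_const_nat.
by apply: ler_sum_nat => i /andP[_ ni]; apply: ler_wiXn2l; [exact: ltW|exact: ltW|exact: ltnW].
Qed.

Lemma asymp_ratio (d : nat) (c : R) f : 0 < c -> asymp d c f ->
  exists2 K : R, 0 <= K & forall n : nat, (0 < n)%N ->
    `|f n / (c * (n%:R ^+ d / d`!%:R)) - 1| <= K / n%:R.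
Proof.
move=> c0 [K [rho [K0 r0 r1 H]]]; have [A A0 HA] := fact_bin_addn_ratio d.
have cz : c != 0 by rewrite gt_eqF.
have fz : d`!%:R != 0 :> R by rewrite pnatr_eq0 -lt0n fact_gt0.
(* [K1 / n] bounds the error shape divided by [n ^ d], using [n + 1 <= 2 n] in positive degree. *)
pose K1 : R := if d is d'.+1 then 2 ^+ d' else (1 - rho)^-1.
have K10 : 0 <= K1.
  by rewrite /K1; case: (d) => [|d']; rewrite ?exprn_ge0 // invr_ge0 subr_ge0 ltW.
have q0 : 0 <= d`!%:R / c by rewrite divr_ge0 // ltW.
exists (K * K1 * (d`!%:R / c) + A); first by rewrite addr_ge0 // (mulr_ge0 _ q0) // mulr_ge0.
move=> n n0; have n0' : 0 < n%:R :> R by rewrite ltr0n.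
have nz : n%:R ^+ d != 0 :> R by rewrite expf_neq0 // gt_eqF.
have -> : f n / (c * (n%:R ^+ d / d`!%:R)) - 1 =
    (f n - c * 'C(n + d, d)%:R) / n%:R ^+ d * (d`!%:R / c) +
    ('C(n + d, d)%:R * d`!%:R / n%:R ^+ d - 1).
  move: nz fz; move: (n%:R ^+ d) (d`!%:R) ('C(_, _)%:R) => P Q B Pz Qz; field.
  by rewrite Qz cz Pz.
apply: le_trans (ler_normD _ _) _; rewrite [leRHS]mulrDl; apply: lerD; last exact: HA.
rewrite normrM (ger0_norm q0) mulrAC; apply: ler_wpM2r => //.
rewrite normrM normfV (ger0_norm (exprn_ge0 _ (ltW n0'))) ler_pdivrMr ?exprn_gt0 //.
apply: le_trans (H n) _; rewrite -!mulrA; apply: ler_wpM2l => //.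
rewrite /K1; case: (d) => [|d']; first by rewrite expr0 mulr1 geometric_le_inv.
rewrite exprS mulKf ?gt_eqF // -exprMn; apply: lerXn2r; rewrite ?nnegrE ?mulr_ge0 //.
by rewrite -natrM ler_nat; lia.
Qed.

End RelativeError.

Theorem theorem11 (R : realType) (r k : nat) (hk : (0 < k)%N) :
  exists e : nat -> R,
    e =O_\oo (fun n : nat => n%:R^-1 : R) /\
    \forall n \near \oo,
      (count_av123 k r n)%:R =
        (4 * sin (pi / k.+1%:R) ^+ 2 / k.+1%:R) ^+ r.+1
        * (n%:R ^+ r / r`!%:R)
        * (4 * cos (pi / k.+1%:R) ^+ 2) ^+ (n - r)
        * (1 + e n).
Proof.
case: k hk => [//|[|g]] _.
  (* For [k = 1], [cos (pi / 2) = 0] kills the main term once [n > r], and the count is 0 too. *)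
  exists (fun=> 0); split.
    apply/eqO_exP; exists 1 => //; near=> n; rewrite normr0 mul1r; exact: normr_ge0.
  near=> n; have rn : (r < n)%N by near: n; exists r.+1.
  rewrite cos_pihalf expr0n mulr0 expr0n subn_eq0 leqNgt rn mulr0 mul0r.
  by rewrite count_av123_singleton.
(* The factor [lam ^- r] hidden in [gain ^+ r] turns [lam ^+ n] into the stated power [n - r]. *)
pose c : R := weight R g 0 * gain R g ^+ r; pose lam := @lead R g.+2.
have l0 : 0 < lam := lead_gt0 R g.
have s0 : 0 < sin (@angle R g.+2) by have := @sin_angle_gt0 R g.+2 1 isT isT; rewrite mul1r.
have w0 : weight R g 0 = 4 * sin (@angle R g.+2) ^+ 2 / g.+3%:R.
  by rewrite /weight mul1r; ring.
have k0 : 0 < 4 * sin (@angle R g.+2) ^+ 2 / g.+3%:R by rewrite divr_gt0 ?mulr_gt0 ?exprn_gt0.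
have c0 : 0 < c by rewrite /c w0 /gain mulr_gt0 // exprn_gt0 // divr_gt0.
have := @asymp_walks R g r 0; rewrite min0n => /(asymp_ratio c0)[K K0 HK].
(* [e] is the exact relative error, so the equation is algebra and only the bound needs the
   asymptotics. *)
exists (fun n => (walks g.+1 r 0 n)%:R / lam ^+ n / (c * (n%:R ^+ r / r`!%:R)) - 1); split.
  apply/eqO_exP; exists (K + 1); first by rewrite ltr_wpDl.
  near=> n; have n0 : (0 < n)%N by near: n; exists 1%N.
  apply: le_trans (HK n n0) _; rewrite ger0_norm ?invr_ge0 //.
  by rewrite ler_wpM2r ?invr_ge0 // lerDl.
near=> n; have n0 : (0 < n)%N by near: n; exists 1%N.
have rn : (r <= n)%N by near: n; exists r.
rewrite count_av123E -[pi / _]/(@angle R g.+2).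
have -> : 4 * cos (@angle R g.+2) ^+ 2 = lam by rewrite /lam /lead exprMn; ring.
set q := 4 * sin _ ^+ 2 / _; set m := n%:R ^+ r / _.
have m0 : m != 0 by rewrite mulf_neq0 ?invr_eq0 ?expf_neq0 ?pnatr_eq0 -?lt0n ?fact_gt0.
have -> : q ^+ r.+1 * m * lam ^+ (n - r) = c * m * lam ^+ n.
  have -> : lam ^+ n = lam ^+ r * lam ^+ (n - r) by rewrite -exprD subnKC.
  have -> : c = q * (q ^+ r / lam ^+ r) by rewrite /c w0 /gain expr_div_n.
  by rewrite [q ^+ r.+1]exprS; field; rewrite expf_neq0 // gt_eqF.
by rewrite addrC subrK; field; rewrite m0 expf_neq0 ?gt_eqF.
Unshelve. all: by end_near.
Qed.
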